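(* Let $T$ be a nonplanar rooted binary tree with leaf set $L(T)$. Then the terms of the coproduct $\Delta(T)$ (one term for the total cut and one term for each binary-admissible cut of $T$, counted as separate terms even if they give equal tensors) are in bijection with the subsets of $L(T)$.
   Context: A (nonplanar rooted) binary tree is a finite rooted tree, without a planar embedding, in which every vertex has either $0$ or $2$ children; vertices with $0$ children are the leaves (the single-vertex tree has one leaf). Leaves may carry labels from a fixed set; leaves of $T$ are regarded as distinct objects even when their labels coincide. Edges are directed away from the root, and the parent vertex of an edge is its upper endpoint. $E(T)$ is the edge set. Let $k$ be a field of characteristic $0$, and let $\mathcal{H}=k[\mathcal{T}]$ be the polynomial algebra on the set $\mathcal{T}$ of isomorphism classes of binary trees; it has as basis the forests (multisets of binary trees), with the empty forest equal to $1$. A binary-admissible cut of $T$ is a subset $C\subseteq E(T)$ such that (1) no two edges of $C$ lie on the same path from the root to a leaf, and (2) no two edges of $C$ share the same parent vertex. The empty set is binary-admissible. For such $C$, delete the edges of $C$ from $T$: $P^C(T)$ is the forest of the subtrees lying below the edges of $C$, and $R^C(T)$ is the full binary tree obtained from the component containing the root of $T$ by edge contraction, i.e. by suppressing all vertices having exactly one child (including the root, if it has exactly one child), leaf labels being kept. In addition there is the total cut, contributing the term $T\otimes 1$. The coproduct is $$\Delta(T)=T\otimes 1+\sum_{C\ \text{binary-admissible cut of }T}P^C(T)\otimes R^C(T).$$ *)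

(* Defs.v *)
From HB Require Import structures.
From mathcomp Require Import all_boot all_order all_algebra.
From mathcomp Require Import boolp.
From mathcomp Require Import finmap monalg.

Set Implicit Arguments.
Unset Strict Implicit.
Unset Printing Implicit Defensive.

Import GRing.Theory.
Local Open Scope ring_scope.
Local Open Scope quotient_scope.

Section RootedTree.
Variable V : finType.
Implicit Types (g : rel V) (r v w : V).

Definition outdeg g v : nat := #|[set w | g v w]|.

(* [g v w] reads "there is an edge directed from v down to w". Acyclicity is a
   consequence of the three fields (see [tree_acyclic]). *)
Record rooted_tree g r : Prop := RootedTree {
  root_noparent : forall v, ~~ g v r;
  parent_uniq : forall v v' w, g v w -> g v' w -> v = v';
  root_connect : forall v, connect g r v }.

End RootedTree.

(* Nonplanar: the two children of an internal vertex form an unordered set.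
   Labels sit on leaves only, so equal labels do not identify leaves. *)
Record btree (A : Type) (V : finType) := BTree {
  root : V;
  child : rel V;
  _ : rooted_tree child root;
  _ : forall v, outdeg child v = 0%N \/ outdeg child v = 2%N;
  label : {v : V | outdeg child v == 0%N} -> A }.

Section BasicNotions.
Variables (A : Type) (V : finType) (T : btree A V).

Lemma btree_rooted : rooted_tree (child T) (root T).
Proof. by case: T. Qed.

Lemma btree_binary v : outdeg (child T) v = 0%N \/ outdeg (child T) v = 2%N.
Proof. by case: T => r c h b l; apply: b. Qed.

Definition leaf := {v : V | outdeg (child T) v == 0%N}.
Definition edge := {e : V * V | child T e.1 e.2}.

HB.instance Definition _ := Finite.on leaf.
HB.instance Definition _ := Finite.on edge.

Definition upper (e : edge) : V := (val e).1.
Definition lower (e : edge) : V := (val e).2.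

(* [root T :: p] is the list of vertices of a path from the root to a leaf. *)
Definition root_leaf_path (p : seq V) : Prop :=
  path (child T) (root T) p /\ outdeg (child T) (last (root T) p) = 0%N.

Definition lies_on (e : edge) (p : seq V) : Prop :=
  (upper e, lower e) \in zip (root T :: p) p.

Definition admissible (C : {set edge}) : Prop :=
  (forall e e', e \in C -> e' \in C -> e <> e' ->
     ~ exists p, [/\ root_leaf_path p, lies_on e p & lies_on e' p]) /\
  (forall e e', e \in C -> e' \in C -> e <> e' -> upper e <> upper e').

Definition cut := {C : {set edge} | `[< admissible C >]}.

HB.instance Definition _ := Finite.on cut.

End BasicNotions.

Section Isomorphism.
Variable A : Type.

Definition iso (V V' : finType) (T : btree A V) (T' : btree A V') : Prop :=
  exists f : V -> V',
    [/\ bijective f, f (root T) = root T',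
        forall v w, child T' (f v) (f w) = child T v w &
        forall (l : leaf T) (l' : leaf T'), f (val l) = val l' ->
          label l = label l'].

Lemma iso_outdeg (V V' : finType) (T : btree A V) (T' : btree A V')
    (f : V -> V') :
  bijective f -> (forall v w, child T' (f v) (f w) = child T v w) ->
  forall v, outdeg (child T') (f v) = outdeg (child T) v.
Proof.
move=> bf fc v; rewrite /outdeg -(card_imset _ (bij_inj bf)).
case: (bf) => g fK gK; apply: eq_card => w; rewrite !inE.
apply/idP/imsetP => [h|[w' + ->]]; last by rewrite inE fc.
by exists (g w); rewrite ?inE ?gK // -fc gK.
Qed.

Lemma iso_refl (V : finType) (T : btree A V) : iso T T.
Proof.
exists id; split=> //; first by exists id.
by move=> l l' e; congr (label _); apply: val_inj.
Qed.

Lemma iso_sym (V V' : finType) (T : btree A V) (T' : btree A V') :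
  iso T T' -> iso T' T.
Proof.
case=> f [bf fr fc fl]; case: (bf) => g fK gK; exists g; split.
- by exists f.
- by rewrite -fr fK.
- by move=> v w; rewrite -fc !gK.
- by move=> l l' e; apply/esym/fl; rewrite -e gK.
Qed.

Lemma iso_trans (V1 V2 V3 : finType) (T1 : btree A V1) (T2 : btree A V2)
    (T3 : btree A V3) : iso T1 T2 -> iso T2 T3 -> iso T1 T3.
Proof.
case=> f [bf fr fc fl] [g [bg gr gc gl]]; exists (g \o f); split.
- exact: bij_comp.
- by rewrite /= fr.
- by move=> v w; rewrite /= gc fc.
move=> l l3 /= e.
have h : outdeg (child T2) (f (val l)) == 0%N.
  by rewrite (iso_outdeg bf fc) (valP l).
rewrite (fl l (Sub (f (val l)) h)) //.
by rewrite (gl (Sub (f (val l)) h) l3).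
Qed.

(* Copy of a tree on the vertex set 'I_#|V|. *)
Section Copy.
Variables (V : finType) (T : btree A V).

Definition copy_child : rel 'I_#|V| :=
  fun i j => child T (enum_val i) (enum_val j).

Lemma copy_outdeg i : outdeg copy_child i = outdeg (child T) (enum_val i).
Proof.
rewrite /outdeg -(card_imset _ (@enum_val_inj V V)).
apply: eq_card => w; rewrite !inE.
apply/imsetP/idP => [[j + ->]|h]; first by rewrite inE.
by exists (enum_rank w); rewrite ?inE /copy_child enum_rankK.
Qed.

Lemma copy_rooted : rooted_tree copy_child (enum_rank (root T)).
Proof.
have [h1 h2 h3] := btree_rooted T; split.
- by move=> v; rewrite /copy_child enum_rankK.
- by move=> v v' w h h'; apply: enum_val_inj; apply: h2 h h'.
move=> v; rewrite -[v]enum_valK; move: (h3 (enum_val v)).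
case/connectP=> p pp ->; apply/connectP; exists (map enum_rank p).
  rewrite path_map; apply: sub_path pp => x y.
  by rewrite /= /copy_child !enum_rankK.
by rewrite last_map.
Qed.

Lemma copy_binary i : outdeg copy_child i = 0%N \/ outdeg copy_child i = 2%N.
Proof. by rewrite copy_outdeg; apply: btree_binary. Qed.

Lemma copy_leafP (l : {i | outdeg copy_child i == 0%N}) :
  outdeg (child T) (enum_val (val l)) == 0%N.
Proof. by rewrite -copy_outdeg (valP l). Qed.

Definition copy_label (l : {i | outdeg copy_child i == 0%N}) : A :=
  @label A V T (exist _ (enum_val (val l)) (copy_leafP l)).

Definition copy : btree A 'I_#|V| :=
  @BTree A _ (enum_rank (root T)) copy_child copy_rooted copy_binary copy_label.

Lemma iso_copy : iso T copy.
Proof.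
exists enum_rank; split=> //.
- exact: enum_rank_bij.
- by move=> v w; rewrite /= /copy_child !enum_rankK.
move=> l l' e; rewrite /= /copy_label; congr (label _); apply: val_inj => /=.
by rewrite -e enum_rankK.
Qed.

End Copy.

(* All trees over varying vertex types do not form a choiceType, for universe
   reasons; those with vertex set some 'I_n do, and up to isomorphism they
   exhaust all trees ([iso_copy]). *)
Definition ord_btree := {classic {n : nat & btree A 'I_n}}.

Definition ord_iso (x y : ord_btree) : bool :=
  `[< iso (projT2 x) (projT2 y) >].

Lemma ord_iso_refl : reflexive ord_iso.
Proof. by move=> x; apply/asboolP/iso_refl. Qed.

Lemma ord_iso_sym : symmetric ord_iso.
Proof. by move=> x y; apply/asboolP/asboolP => /iso_sym. Qed.

Lemma ord_iso_trans : transitive ord_iso.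
Proof.
by move=> y x z /asboolP xy /asboolP yz; apply/asboolP/(iso_trans xy yz).
Qed.

Canonical ord_iso_equiv :=
  EquivRel ord_iso ord_iso_refl ord_iso_sym ord_iso_trans.

Definition tree_class := {eq_quot ord_iso}.

HB.instance Definition _ := Choice.on tree_class.

Definition class_of (V : finType) (T : btree A V) : tree_class :=
  \pi_tree_class (existT _ #|V| (copy T) : ord_btree).

Lemma class_ofP (V V' : finType) (T : btree A V) (T' : btree A V') :
  class_of T = class_of T' <-> iso T T'.
Proof.
split=> [/eqmodP/asboolP /= h | h].
  exact: iso_trans (iso_copy T) (iso_trans h (iso_sym (iso_copy T'))).
apply/eqmodP/asboolP => /=.
exact: iso_trans (iso_sym (iso_copy T)) (iso_trans h (iso_copy T')).
Qed.

End Isomorphism.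

Section RootedForest.
Variables (V : finType) (g : rel V) (r : V).
Hypothesis noparent : forall v, ~~ g v r.
Hypothesis uniq_parent : forall v v' w, g v w -> g v' w -> v = v'.

Lemma connect_lastP v w :
  connect g v w -> v = w \/ exists2 u, connect g v u & g u w.
Proof.
case/connectP=> p; case/lastP: p => [_ -> | p u]; first by left.
rewrite rcons_path last_rcons => /andP[pp h] ->; right.
by exists (last v p) => //; apply/connectP; exists p.
Qed.

Lemma tree_acyclic v w : connect g r v -> g v w -> ~~ connect g w v.
Proof.
case/connectP=> p; elim/last_ind: p v w => [|p u IH] v w.
  move=> _ /= -> h; apply/negP => /connect_lastP[e|[u _]].
    by rewrite e in h; have := noparent r; rewrite h.
  exact/negP/noparent.
rewrite rcons_path last_rcons => /andP[pp h] -> gw; apply/negP.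
have n := IH _ u pp (erefl _) h.
case/connect_lastP=> [e|[x c gx]].
  have e' : u = last r p by apply: uniq_parent h; rewrite -{2}e.
  by move: n; rewrite -e' connect0.
move: n; rewrite -(uniq_parent gx h) => /negP; apply.
exact: connect_trans (connect1 gw) c.
Qed.

Lemma connect_comparable v v' w :
  connect g v w -> connect g v' w -> connect g v v' \/ connect g v' v.
Proof.
case/connectP=> p; elim/last_ind: p w => [|p u IH] w.
  by move=> _ -> h; right.
rewrite rcons_path last_rcons => /andP[pp h] ->.
case/connect_lastP=> [e|[x c gx]].
  left; rewrite e; apply: connect_trans (connect1 h).
  by apply/connectP; exists p.
by apply: (IH _ pp (erefl _)); rewrite -(uniq_parent gx h).
Qed.

Section Suppression.

Definition suppressed v := outdeg g v == 1%N.
Definition skip : rel V := fun x y => suppressed x && g x y.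
Definition remaining v := connect g r v && ~~ suppressed v.

Lemma skip_connect v w : connect skip v w -> connect g v w.
Proof. by apply: connect_sub => x y /andP[_ /connect1]. Qed.

Lemma remaining_ex v :
  connect g r v -> exists2 w, connect skip v w & ~~ suppressed w.
Proof.
elim: {v}_.+1 {-2}v (ltnSn #|[set x | connect g v x]|) => // n IH v.
rewrite ltnS => le cv.
have [s|] := boolP (suppressed v); last by exists v.
have [w] : exists w, w \in [set w | g v w].
  by apply/set0Pn; rewrite -card_gt0 -/(outdeg g v) (eqP s).
rewrite inE => gvw.
have [||x h nx] := IH w.
- apply: leq_trans le; apply/proper_card/properP; split.
    by apply/subsetP=> x; rewrite !inE; apply/connect_trans/connect1.
  by exists v; rewrite !inE ?connect0 // tree_acyclic.
- exact: connect_trans cv (connect1 gvw).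
exists x => //; apply: connect_trans h; apply: connect1.
by rewrite /skip s.
Qed.

Lemma skip_fun x y z : skip x y -> skip x z -> y = z.
Proof.
case/andP=> /cards1P[w e] h /andP[_ h'].
have: y \in [set w | g x w] by rewrite inE.
have: z \in [set w | g x w] by rewrite inE.
by rewrite e !inE => /eqP -> /eqP ->.
Qed.

Lemma remaining_uniq v w w' :
  connect skip v w -> ~~ suppressed w ->
  connect skip v w' -> ~~ suppressed w' -> w = w'.
Proof.
case/connectP=> p; elim: p v => [|x p IH] v /=.
  move=> _ -> nv /connectP[[|y q] /=]; first by [].
  by case/andP=> /andP[h]; rewrite h in nv.
case/andP=> sx pp e nw /connectP[[|y q] /=].
  by move=> _ -> nv; case/andP: sx => h; rewrite h in nv.
case/andP=> sy pq e' nw'; apply: (IH x) => //.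
by apply/connectP; exists q; rewrite (skip_fun sx sy).
Qed.

Definition rvert := {v : V | remaining v}.

HB.instance Definition _ := Finite.on rvert.

(* An edge from u to w remains after contraction when w is reached from u by
   one edge followed by edges starting at suppressed vertices only. *)
Definition contracted : rel rvert :=
  fun u w => [exists v, g (val u) v && connect skip v (val w)].

Lemma remaining_sub v :
  connect g r v -> exists w : rvert, connect skip v (val w).
Proof.
move=> c; have [w h nw] := remaining_ex c.
have rw : remaining w.
  by rewrite /remaining nw andbT; apply/(connect_trans c)/skip_connect.
by exists (Sub w rw).
Qed.

Lemma new_root_ex : exists w : rvert, connect skip r (val w).
Proof. exact: remaining_sub. Qed.

Definition new_root : rvert := xchoose new_root_ex.

Lemma new_rootP : connect skip r (val new_root).
Proof. exact: (xchooseP new_root_ex). Qed.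

Lemma rvert_ns (w : rvert) : ~~ suppressed (val w).
Proof. by case/andP: (valP w). Qed.

Lemma rvert_c (w : rvert) : connect g r (val w).
Proof. by case/andP: (valP w). Qed.

(* A connected chain of skipped vertices contains no remaining vertex other
   than its end. *)
Lemma skip_between v u v' w :
  connect skip v w -> connect g v u -> g u v' -> connect g v' w ->
  connect g r v -> suppressed u.
Proof.
case/connectP=> p; elim/last_ind: p w => [|p x IH] w.
  move=> _ -> vu uv' c cr.
  have := tree_acyclic (connect_trans cr vu) uv'.
  by rewrite (connect_trans c vu).
rewrite rcons_path last_rcons => /andP[pp /andP[s h]] -> vu uv'.
case/connect_lastP=> [e|[y c gy]] cr.
  by rewrite e in uv'; rewrite (uniq_parent uv' h).
by apply: (IH _ pp (erefl _)) => //; rewrite -(uniq_parent gy h).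
Qed.

Lemma contracted_rooted : rooted_tree contracted new_root.
Proof.
split.
- move=> u; apply/existsP => -[v /andP[guv c]].
  have cu := rvert_c u; move/negP: (rvert_ns u); apply.
  exact: skip_between new_rootP cu guv (skip_connect c) (connect0 _ _).
- move=> u u' w /existsP[v /andP[uv c]] /existsP[v' /andP[uv' c']].
  apply: val_inj.
  have crv := connect_trans (rvert_c u) (connect1 uv).
  have crv' := connect_trans (rvert_c u') (connect1 uv').
  case: (connect_comparable (skip_connect c) (skip_connect c')) => h.
  + case: (connect_lastP h) => [e|[x cx gx]].
      by rewrite -e in uv'; apply: uniq_parent uv uv'.
    rewrite (uniq_parent gx uv') in cx.
    by case/negP: (rvert_ns u'); apply: skip_between c cx uv' (skip_connect c') crv.
  + case: (connect_lastP h) => [e|[x cx gx]].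
      by rewrite e in uv'; apply: uniq_parent uv uv'.
    rewrite (uniq_parent gx uv) in cx.
    by case/negP: (rvert_ns u); apply: skip_between c' cx uv (skip_connect c) crv'.
suff H v : connect g r v ->
    forall w : rvert, connect skip v (val w) -> connect contracted new_root w.
  by move=> w; apply: (H _ (rvert_c w)); apply: connect0.
case/connectP=> p; elim/last_ind: p v => [|p x IH] v.
  move=> _ -> w h; suff -> : w = new_root by apply: connect0.
  by apply: val_inj; apply: remaining_uniq h _ new_rootP _; apply: rvert_ns.
rewrite rcons_path last_rcons => /andP[pp h] -> w xw.
have [s|ns] := boolP (suppressed (last r p)).
  apply: (IH _ pp (erefl _)); apply: connect_trans xw; apply: connect1.
  by rewrite /skip s.
have rl : remaining (last r p).
  by rewrite /remaining ns andbT; apply/connectP; exists p.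
have := IH _ pp (erefl _) (Sub (last r p) rl) (connect0 _ _).
move/connect_trans; apply; apply: connect1; apply/existsP; exists x.
by rewrite /= h.
Qed.

Lemma contracted_outdeg u : outdeg contracted u = outdeg g (val u).
Proof.
pose nx v : V := if [pick w : rvert | connect skip v (val w)] is Some w
                 then val w else v.
have nxP v : g (val u) v -> connect skip v (nx v) /\ remaining (nx v).
  move=> h; rewrite /nx; case: pickP => [w hw|no]; first by split=> //; exact: valP.
  have [w hw] := remaining_sub (connect_trans (rvert_c u) (connect1 h)).
  by rewrite no in hw.
rewrite /outdeg -(card_imset _ val_inj).
have inj : {in [set w | g (val u) w] &, injective nx}.
  move=> v v'; rewrite !inE => h h' e.
  have [c _] := nxP _ h; have [c' _] := nxP _ h'; rewrite -e in c'.
  have cu := rvert_c u.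
  case: (connect_comparable (skip_connect c) (skip_connect c')) => k.
  + case: (connect_lastP k) => // -[x cx gx].
    rewrite (uniq_parent gx h') in cx.
    by move: (tree_acyclic cu h); rewrite cx.
  + case: (connect_lastP k) => // -[x cx gx].
    rewrite (uniq_parent gx h) in cx.
    by move: (tree_acyclic cu h'); rewrite cx.
rewrite -(card_in_imset inj); apply: eq_card => w.
apply/imsetP/imsetP => -[x]; rewrite inE => h ->.
  case/existsP: h => v /andP[h c]; exists v; rewrite ?inE //.
  have [c' /andP[_ n]] := nxP _ h.
  by apply: remaining_uniq c _ c' n; apply: rvert_ns.
have [c rx] := nxP _ h; exists (Sub (nx x) rx); rewrite ?inE //.
by apply/existsP; exists x; rewrite h.
Qed.

End Suppression.
End RootedForest.

Section CutTrees.
Variables (A : Type) (V : finType) (T : btree A V).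

Section Subtree.
Variable u : V.

Definition subvert := {v : V | connect (child T) u v}.

HB.instance Definition _ := Finite.on subvert.

Definition sub_child : rel subvert := fun v w => child T (val v) (val w).

Definition sub_root : subvert := exist _ u (connect0 _ _).

Lemma sub_outdeg v : outdeg sub_child v = outdeg (child T) (val v).
Proof.
rewrite /outdeg -(card_imset _ val_inj); apply: eq_card => w.
apply/imsetP/idP => [[x + ->]|]; rewrite !inE // => h.
have c : connect (child T) u w by apply: connect_trans (valP v) (connect1 h).
by exists (Sub w c); rewrite ?inE.
Qed.

Lemma sub_rooted : rooted_tree sub_child sub_root.
Proof.
have [h1 h2 h3] := btree_rooted T; split.
- move=> v; apply/negP => h.
  by move: (tree_acyclic h1 h2 (h3 _) h); rewrite (valP v).
- by move=> v v' w h h'; apply: val_inj; apply: h2 h h'.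
case=> v cv; case/connectP: (cv) => p.
elim/last_ind: p v cv => [|p x IH] v cv.
  by move=> _ e; rewrite (_ : exist _ _ _ = sub_root) ?connect0 //; apply: val_inj.
rewrite rcons_path last_rcons => /andP[pp h] e.
have cl : connect (child T) u (last u p) by apply/connectP; exists p.
apply: connect_trans (IH _ cl pp (erefl _)) (connect1 _).
by rewrite /sub_child /= e.
Qed.

Lemma sub_binary v : outdeg sub_child v = 0%N \/ outdeg sub_child v = 2%N.
Proof. by rewrite sub_outdeg; apply: btree_binary. Qed.

Lemma sub_leafP (l : {v | outdeg sub_child v == 0%N}) :
  outdeg (child T) (val (val l)) == 0%N.
Proof. by rewrite -sub_outdeg (valP l). Qed.

Definition subtree : btree A subvert :=
  @BTree A _ sub_root sub_child sub_rooted sub_binary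
    (fun l => @label A V T (exist _ (val (val l)) (sub_leafP l))).

End Subtree.

Section Trunk.
Variable C : cut T.

Definition uncut : rel V :=
  fun v w => child T v w && [forall e in val C, val e != (v, w)].

Lemma uncut_noparent v : ~~ uncut v (root T).
Proof. by rewrite /uncut negb_and (root_noparent (btree_rooted T)). Qed.

Lemma uncut_parent v v' w : uncut v w -> uncut v' w -> v = v'.
Proof.
by case/andP=> h _ /andP[h' _]; apply: parent_uniq (btree_rooted T) _ _ _ h h'.
Qed.

(* By condition (2) on cuts, a vertex loses at most one of its children. *)
Lemma uncut_outdeg v :
  outdeg uncut v = outdeg (child T) v \/
  (outdeg uncut v = 1%N /\ outdeg (child T) v = 2%N).
Proof.
have [_ adm] : admissible (val C) by apply/asboolP/(valP C).
have [/existsP[e /andP[eC /eqP ev]]|/negP no] :=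
    boolP [exists e in val C, upper e == v]; last first.
  left; apply: eq_card => w; rewrite !inE /uncut andbC.
  case: forallP => //= h; apply/esym/negP => cvw; apply: h => e.
  apply/implyP => eC; apply/eqP => ee; case: no; apply/existsP; exists e.
  by rewrite eC; apply/eqP; exact: (congr1 fst ee).
have cve : child T v (lower e) by rewrite -ev; apply: (valP e).
have E : [set w | child T v w] = lower e |: [set w | uncut v w].
  apply/setP => w; rewrite !inE /uncut.
  have [-> //|ne] := eqVneq w (lower e).
  case cw: (child T v w) => //=; apply/esym/forallP => e'; apply/implyP => e'C.
  apply/eqP => ee'; case: (adm _ _ eC e'C).
    by move=> k; case/eqP: ne; rewrite k; apply/esym; exact: (congr1 snd ee').
  by rewrite ev; apply/esym; exact: (congr1 fst ee').
have N : lower e \notin [set w | uncut v w].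
  rewrite inE /uncut cve /=; apply/forallPn; exists e.
  by rewrite eC /= -ev negbK; apply/eqP; apply: surjective_pairing.
have O : outdeg (child T) v = (outdeg uncut v).+1.
  by rewrite {1}/outdeg E cardsU1 N.
by right; case: (btree_binary T v); rewrite O => // -[->].
Qed.

Local Notation new_child := (@contracted V uncut (root T)).

Lemma trunk_binary v : outdeg new_child v = 0%N \/ outdeg new_child v = 2%N.
Proof.
rewrite (contracted_outdeg uncut_noparent uncut_parent).
case: (uncut_outdeg (val v)) => [->|[h _]]; first exact: btree_binary.
by move: (rvert_ns v); rewrite /suppressed h.
Qed.

Lemma trunk_leafP (l : {v | outdeg new_child v == 0%N}) :
  outdeg (child T) (val (val l)) == 0%N.
Proof.
have := valP l; rewrite (contracted_outdeg uncut_noparent uncut_parent).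
by case: (uncut_outdeg (val (val l))) => [->|[->]].
Qed.

(* Remaining vertices: those of the root component of T minus C that do not
   have exactly one child there. *)
Definition trunk : btree A (rvert uncut (root T)) :=
  @BTree A _ (new_root uncut_noparent uncut_parent) new_child
    (contracted_rooted uncut_noparent uncut_parent) trunk_binary
    (fun l => @label A V T (exist _ (val (val l)) (trunk_leafP l))).

End Trunk.
End CutTrees.

(* The polynomial algebra k[tree_class A]: monomials are multisets of classes
   of trees, i.e. forests. *)
Definition forest (A : Type) := {cmonom (tree_class A)}.
HB.instance Definition _ (A : Type) := ConomialDef.on (forest A).

Definition Halg (k : fieldType) (A : Type) := {malg k[forest A]}.
HB.instance Definition _ (k : fieldType) (A : Type) :=
  GRing.ComAlgebra.on (Halg k A).

(* H (x) H, as the free k-module on pairs of basis elements of H. *)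
Definition Htens (k : fieldType) (A : Type) :=
  {malg k[(forest A * forest A)%type]}.
HB.instance Definition _ (k : fieldType) (A : Type) :=
  GRing.Lmodule.on (Htens k A).

Definition tens (k : fieldType) (A : Type) (a b : Halg k A) : Htens k A :=
  \sum_(p <- msupp a) \sum_(q <- msupp b) << a@_p * b@_q *g (p, q) >>.

(* A sum together with its individual terms: distinct indices are distinct
   terms, even when the summands coincide. *)
Record formal_sum (M : nmodType) := FormalSum {
  term : finType;
  summand : term -> M }.

Definition fsum_value (M : nmodType) (s : formal_sum M) : M :=
  \sum_(t : term s) summand t.

Section Coproduct.
Variables (k : fieldType) (A : Type) (V : finType) (T : btree A V).

Definition treeH (W : finType) (S : btree A W) : Halg k A :=
  << ucm (class_of S) >>.

Definition pruned (C : cut T) : Halg k A :=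
  \prod_(e in val C) treeH (subtree T (lower e)).

(* The index None is the total cut. *)
Definition coproduct_summand (t : option (cut T)) : Htens k A :=
  if t is Some C then tens (pruned C) (treeH (trunk C)) else tens (treeH T) 1.

Definition coproduct_terms : formal_sum (Htens k A) :=
  FormalSum coproduct_summand.

Definition coproduct : Htens k A := fsum_value coproduct_terms.

End Coproduct.

(* Main.v *)
Require Import Defs.
From mathcomp Require Import all_boot all_order all_algebra.
From mathcomp Require Import boolp.

(** A cut is encoded by the set of leaves lying below its edges, and the total
    cut by the set of all leaves. Conversely, a proper subset [S] of the leaves
    comes from the edges above the maximal vertices all of whose leaves lie in
    [S]. Condition (1) on cuts says that these vertices are incomparable, and
    condition (2), since every internal vertex has exactly two children, that
    they are maximal. *)

Import GRing.Theory.
Local Open Scope ring_scope.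

Section Cuts.
(* MathComp shadows [root] and [root_connect]. *)
Import Defs.
Set Implicit Arguments.
Unset Strict Implicit.
Variables (A : Type) (V : finType) (T : btree A V).
Implicit Types (u v w : V) (e : edge T) (l : leaf T).
Implicit Types (C : {set edge T}) (S : {set leaf T}).

Local Notation "u ~> v" := (connect (child T) u v) (at level 70).

(** Induction on the number of descendants: by acyclicity [v] is not below its child [w], so [w] has
    strictly fewer. *)
Lemma btree_ind (P : V -> Prop) :
  (forall v, (forall w, child T v w -> P w) -> P v) -> forall v, P v.
Proof.
have [h1 h2 h3] := btree_rooted T.
move=> H v; elim: {v}_.+1 {-2}v (ltnSn #|[set x | v ~> x]|) => // n IH v.
rewrite ltnS => le; apply: H => w vw; apply: IH; apply: leq_trans le.
apply/proper_card/properP; split.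
  by apply/subsetP => x; rewrite !inE; apply/connect_trans/connect1.
by exists v; rewrite !inE ?connect0 ?(tree_acyclic h1 h2 (h3 v) vw).
Qed.

Lemma leaf_no_child l w : ~~ child T (val l) w.
Proof.
by have /eqP/cards0_eq/setP/(_ w) := valP l; rewrite !inE => ->.
Qed.

Lemma connect_leaf l w : val l ~> w -> w = val l.
Proof.
by case/connectP => [[|x p]] //= /andP[h]; move: (leaf_no_child l x); rewrite h.
Qed.

Lemma connect_child v w :
  v ~> w -> v = w \/ exists2 u, child T v u & u ~> w.
Proof.
case/connectP => [[|x p]] /= => [_ ->|/andP[h pp] ->]; first by left.
by right; exists x => //; apply/connectP; exists p.
Qed.

Lemma edgeP u w : child T u w -> exists2 e : edge T, upper e = u & lower e = w.
Proof. by move=> h; exists (exist _ (u, w) h). Qed.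

Lemma child_edge e : child T (upper e) (lower e).
Proof. exact: valP e. Qed.

Lemma lower_inj : injective (@lower A V T).
Proof.
move=> e e' h; apply: val_inj.
have := child_edge e; rewrite h => ce.
have := parent_uniq (btree_rooted T) ce (child_edge e').
move: h; rewrite /lower /upper.
by case: (val e) (val e') => [a b] [a' b'] /= -> ->.
Qed.

Lemma connect_lower v e : v ~> lower e -> v = lower e \/ v ~> upper e.
Proof.
move=> /connect_lastP[|[u vu h]]; first by left.
by right; rewrite -(parent_uniq (btree_rooted T) h (child_edge e)).
Qed.

Lemma internal_children v : outdeg (child T) v != 0%N ->
  exists e e', [/\ e <> e', upper e = v, upper e' = v &
    forall w, child T v w -> w = lower e \/ w = lower e'].
Proof.
case: (btree_binary T v) => [->|] // /eqP/cards2P[a [b [nab E]]] _.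
have inE' w : child T v w = (w == a) || (w == b).
  by have /setP/(_ w) := E; rewrite !inE.
have [|e eu el] := @edgeP v a; first by rewrite inE' eqxx.
have [|e' eu' el'] := @edgeP v b; first by rewrite inE' eqxx orbT.
exists e, e'; split=> // [ee|w]; first by rewrite -el -el' ee eqxx in nab.
by rewrite inE' el el' => /orP[/eqP|/eqP] ->; [left | right].
Qed.

Definition leaves_below v : {set leaf T} := [set l | v ~> val l].

Lemma leaves_belowS v w : v ~> w -> leaves_below w \subset leaves_below v.
Proof.
by move=> h; apply/subsetP => l; rewrite !inE; apply: connect_trans.
Qed.

Lemma leaves_below_root : leaves_below (root T) = setT.
Proof.
by apply/setP => l; rewrite !inE (root_connect (btree_rooted T)).
Qed.

Lemma leaf_below v : exists l, v ~> val l.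
Proof.
elim/btree_ind: v => v IH.
have [h|/internal_children[e [_ [_ eu _ _]]]] :=
    boolP (outdeg (child T) v == 0%N).
  by exists (exist _ v h); apply: connect0.
have h : child T v (lower e) by rewrite -eu child_edge.
have [l le] := IH _ h.
by exists l; apply: connect_trans (connect1 h) le.
Qed.

(** * Edges on a common root-to-leaf path *)

Lemma zip_path_connect x p a b : path (child T) x p ->
  (a, b) \in zip (x :: p) p -> b ~> last x p.
Proof.
elim: p x => //= y p IH x /andP[xy pp]; rewrite inE.
case/orP => [/eqP[_ ->]|]; last exact: IH.
by apply/connectP; exists p.
Qed.

Lemma mem_zip_path (x b : V) p q :
  (last x p, b) \in zip (x :: p ++ b :: q) (p ++ b :: q).
Proof.
elim: p x => [|y p IH] x /=; first by rewrite mem_head.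
by rewrite inE IH orbT.
Qed.

(** Both lower endpoints lie above the end of [p], so uniqueness of parents makes them comparable;
    they differ because an edge is determined by its lower endpoint. *)
Lemma same_path_connect e e' p : root_leaf_path T p ->
  lies_on e p -> lies_on e' p -> e <> e' ->
  lower e ~> upper e' \/ lower e' ~> upper e.
Proof.
case=> pp _ /(zip_path_connect pp) h /(zip_path_connect pp) h' ne.
have [_ h2 _] := btree_rooted T.
case: (connect_comparable h2 h h') => /connect_lower[/lower_inj ee|c].
- by case: ne.
- by left.
- by case: ne.
- by right.
Qed.

Lemma connect_same_path e e' : lower e ~> upper e' ->
  exists p, [/\ root_leaf_path T p, lies_on e p & lies_on e' p].
Proof.
case/connectP => q pq eq.
have /connectP[p pp ep] := root_connect (btree_rooted T) (upper e).
have [l /connectP[s ps es]] := leaf_below (lower e').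
(* [p] runs from the root to [upper e], [q] from [lower e] to [upper e'], and [s] from [lower e'] to
   a leaf. *)
exists (p ++ lower e :: q ++ lower e' :: s); split.
- split; last by rewrite last_cat /= last_cat /= -es; apply/eqP/(valP l).
  by rewrite cat_path pp /= -ep child_edge cat_path pq /= -eq child_edge ps.
- by rewrite /lies_on ep mem_zip_path.
rewrite /lies_on eq.
have -> : last (lower e) q = last (root T) (p ++ lower e :: q).
  by rewrite last_cat.
have := mem_zip_path (root T) (lower e') (p ++ lower e :: q) s.
by rewrite -catA.
Qed.

(** * From cuts to sets of leaves *)

Definition pruned_leaves C : {set leaf T} :=
  [set l | [exists e in C, lower e ~> val l]].

(** If no cut edge lies above [v], condition (2) leaves one of its child edges uncut, so no cut edge
    lies above that child either. Descending in this way ends at a leaf that is not pruned. *)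
Lemma subset_pruned_leaves C v : admissible C ->
  (leaves_below v \subset pruned_leaves C) = [exists e in C, lower e ~> v].
Proof.
case=> _ adm; apply/idP/idP; last first.
  case/existsP => e /andP[eC ev]; apply/subsetP => l; rewrite !inE => vl.
  by apply/existsP; exists e; rewrite eC (connect_trans ev vl).
apply: contraTT; elim/btree_ind: v => v IH nv.
have [h|/internal_children[e [e' [ne eu eu' _]]]] :=
    boolP (outdeg (child T) v == 0%N).
  apply/subsetPn; exists (exist _ v h); first by rewrite inE connect0.
  by rewrite inE.
wlog eC : e e' ne eu eu' / e \notin C.
  move=> W; have [eC|] := boolP (e \in C); last exact: (W e e').
  have [e'C|] := boolP (e' \in C); last by apply: (W e' e) => // /esym.
  by case: (adm e e' eC e'C ne); rewrite eu eu'.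
have ve : child T v (lower e) by rewrite -eu child_edge.
apply: contra (IH _ ve _).
  by apply/subset_trans/leaves_belowS/connect1.
apply: contra nv => /existsP[d /andP[dC /connect_lower[/lower_inj de|du]]].
  by rewrite -de dC in eC.
by apply/existsP; exists d; rewrite dC -eu.
Qed.

(** A pruned leaf set equal to [setT] would force a cut edge entering or above the root. This keeps
    [setT] free for the total cut. *)
Lemma pruned_leaves_proper C : admissible C -> pruned_leaves C != setT.
Proof.
move=> adm; have := subset_pruned_leaves (root T) adm.
rewrite leaves_below_root subTset => ->; apply/existsP => -[e /andP[_ h]].
have [h1 h2 h3] := btree_rooted T.
by move: (tree_acyclic h1 h2 (h3 _) (child_edge e)); rewrite (connect_trans h).
Qed.

(** * From sets of leaves to cuts *)

Definition boundary S : {set edge T} :=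
  [set e | (leaves_below (lower e) \subset S) &&
           ~~ (leaves_below (upper e) \subset S)].

(** If one boundary edge lay below another, its upper endpoint would have all its leaves in [S]. Two
    boundary edges with a common parent would exhaust the children of that parent, with the same
    contradiction. *)
Lemma boundary_admissible S : admissible (boundary S).
Proof.
split=> e e'; rewrite !inE => /andP[le ue] /andP[le' ue'] ne.
  case=> p [pp pe pe'].
  case: (same_path_connect pp pe pe' ne) => /leaves_belowS h.
    by rewrite (subset_trans h le) in ue'.
  by rewrite (subset_trans h le') in ue.
move=> uu; case/negP: ue; apply/subsetP => l; rewrite inE.
case/connect_child => [ul|[w uw wl]].
  by have := leaf_no_child l (lower e); rewrite -ul child_edge.
suff [we|we] : w = lower e \/ w = lower e'.
- by apply: (subsetP le); rewrite inE -we.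
- by apply: (subsetP le'); rewrite inE -we.
have : outdeg (child T) (upper e) != 0%N.
  by rewrite -lt0n card_gt0; apply/set0Pn; exists w; rewrite inE.
case/internal_children => d [d' [_ _ _ H]].
(* Each of [w], [lower e] and [lower e'] is one of the two children [lower d], [lower d']; as [e]
   and [e'] differ, [w] must be one of their lower endpoints. *)
case: (H _ uw) (H _ (child_edge e)) => ->.
all: have := child_edge e'; rewrite -uu => /H [] h' [] h; auto.
all: by case: ne; apply: lower_inj; rewrite h h'.
Qed.

Lemma boundaryK S : S != setT -> pruned_leaves (boundary S) = S.
Proof.
move=> nS; apply/setP => l; rewrite inE.
apply/idP/idP => [/existsP[e /andP[]]|lS].
  by rewrite inE => /andP[/subsetP h _] el; apply: h; rewrite inE.
have sl : leaves_below (val l) \subset S.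
  apply/subsetP => l'; rewrite inE => /connect_leaf /val_inj -> //.
have : ~~ (leaves_below (root T) \subset S).
  by rewrite leaves_below_root subTset.
have /connectP[p] := root_connect (btree_rooted T) (val l).
(* Walk down from the root to [l], keeping a vertex [x] with some leaf outside [S]. The first step
   to a vertex with all leaves in [S] crosses a boundary edge. *)
elim: p (root T) => [|y p IH] x /=; first by move=> _ <-; rewrite sl.
case/andP => xy pp ey nx.
have [sy|] := boolP (leaves_below y \subset S); last exact: IH.
have [e eu el] := edgeP xy.
apply/existsP; exists e; rewrite inE eu el sy nx /=.
by apply/connectP; exists p.
Qed.

Lemma pruned_leavesK C : admissible C -> boundary (pruned_leaves C) = C.
Proof.
move=> adm; apply/setP => e; rewrite inE !subset_pruned_leaves //.
apply/andP/idP => [[/existsP[d /andP[dC h]] ne]|eC].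
  case/connect_lower: h => [/lower_inj <- //|h].
  by case/existsP: ne; exists d; rewrite dC.
split; first by apply/existsP; exists e; rewrite eC connect0.
(* A cut edge [d] above [upper e] would give a cycle if [d = e], and otherwise share a root-to-leaf
   path with [e], against condition (1). *)
apply/existsP => -[d /andP[dC h]].
have [de|/eqP ne] := eqVneq d e.
  have [h1 h2 h3] := btree_rooted T.
  by move: (tree_acyclic h1 h2 (h3 _) (child_edge e)); rewrite -{1}de h.
case: adm => adm _; apply: (adm d e dC eC ne); exact: connect_same_path.
Qed.

Definition cut_leaves (t : option (cut T)) : {set leaf T} :=
  if t is Some C then pruned_leaves (val C) else setT.

Lemma cut_leaves_bij : bijective cut_leaves.
Proof.
have badm S : `[< admissible (boundary S) >].
  exact/asboolP/boundary_admissible.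
pose cut_of S : cut T := exist _ (boundary S) (badm S).
exists (fun S => if S == setT then None else Some (cut_of S)).
  case=> [C|] /=; last by rewrite eqxx.
  have /asboolP adm := valP C.
  rewrite (negbTE (pruned_leaves_proper adm)); congr Some.
  by apply: val_inj; apply: pruned_leavesK.
by move=> S; case: eqVneq => [->|/boundaryK].
Qed.

End Cuts.

Theorem proposition2p1 (k : fieldType) (k_char0 : [pchar k] =i pred0)
    (A : Type) (V : finType) (T : btree A V) :
  exists f : term (coproduct_terms k T) -> {set leaf T}, bijective f.
Proof. by exists (@cut_leaves A V T); apply: cut_leaves_bij. Qed.
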